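(* Fix positive integers $\alpha,\beta$ with $2\beta+2\ge\alpha\ge\beta+3$. Let $G_2=G(2,(\{v\},\emptyset))$ (where $(\{v\},\emptyset)$ is the one-node graph) and $G_m=G(m,G_{m-1})$ for every $m\in\mathbb{N}_{\ge3}$ (for any choices of the attachment nodes $u_i$ in the construction). Then for every $m\in\mathbb{N}_{\ge2}$ we have $\text{ffn}(G_m)=m$ and $T(G_m)=T_m(G_m)\ge (m-1)!$, which is superpolynomial in $\text{size}(G_m)=\mathcal{O}(m^6)$.
   Context: All graphs are finite, simple and undirected. For a graph $G=(V,E)$ and $W\subseteq V$, $N(W)$ is the set of nodes in $V\setminus W$ adjacent to at least one node of $W$. For $m\in\mathbb{N}_{>0}$, an $m$-strategy of length $T$ is a sequence $(F_1,\dots,F_T)$ of subsets of $V$ with $|F_i|\le m$. Its burning sets are $B_0=V$ and $B_t=(B_{t-1}\setminus F_t)\cup N(B_{t-1}\setminus F_t)$ for $t\ge1$, where $F_t=\emptyset$ for $t>T$. The strategy is winning if $B_T=\emptyset$. $\text{ffn}(G)$ is the smallest $m$ admitting a winning $m$-strategy; $T_m(G)$ is the shortest length of a winning $m$-strategy ($\infty$ if none exists) and $T(G)=T_{\text{ffn}(G)}(G)$. $\text{size}(G)$ denotes the encoding size of $G$. Auxiliary graph $H_m$ ($m\ge2$): nodes $v_1,\dots,v_{m-1},w_1,\dots,w_\alpha$; the $v_i$ form a clique, and every $v_i$ is adjacent to every $w_j$; there are no other edges. Graph $G(m,X)$, for $m\ge2$ and a graph $X$ with $\text{ffn}(X)=m-1$: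 add to $X$ a new node $c$ adjacent to every node of $X$; add $m$ disjoint paths $(v^i_1,\dots,v^i_\beta)$, $i\in[m]$, with $c$ adjacent to each $v^i_1$; add $m$ disjoint copies $H^1_m,\dots,H^m_m$ of $H_m$, and for each $i\in[m]$ connect $v^i_\beta$ to one (arbitrary) node $u_i$ of the $(m-1)$-clique of $H^i_m$. *)

(* Defs.v *)
From HB Require Import structures.
From mathcomp Require Import all_boot.
From mathcomp Require Import boolp.

Set Implicit Arguments.
Unset Strict Implicit.
Unset Printing Implicit Defensive.

Record sgraph := SGraph {
  vertex :> finType;
  adj : rel vertex;
  adj_sym : symmetric adj;
  adj_irr : irreflexive adj
}.

Section Firefighting.
Variable G : sgraph.

Definition nbhd (W : {set G}) : {set G} :=
  [set y | (y \notin W) && [exists x in W, adj x y]].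

(* The sequence s lists F_1, ..., F_T, so F_t is entry t - 1 of s, and it is
   empty for t > T. *)
Fixpoint burning (s : seq {set G}) (t : nat) : {set G} :=
  if t is t'.+1 then
    let A := burning s t' :\: nth set0 s t' in A :|: nbhd A
  else setT.

Definition strategy (m : nat) (s : seq {set G}) : bool :=
  all (fun F : {set G} => #|F| <= m) s.

Definition winning (s : seq {set G}) : bool := burning s (size s) == set0.

Definition wins_in (m T : nat) : bool :=
  [exists s : T.-tuple {set G}, strategy m s && winning s].

Lemma ffn_exists : exists m, (0 < m) && `[< exists T, wins_in m T >].
Proof.
exists #|G|.+1; rewrite ltn0Sn /=; apply/asboolP; exists 1.
apply/existsP; exists [tuple setT]; rewrite /strategy /winning /=.
rewrite andbT cardsT leqnSn /= setDv set0U; apply/eqP/setP => y.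
rewrite !inE /=; apply/existsP => -[x]; by rewrite inE.
Qed.

Definition ffn : nat := ex_minn ffn_exists.

(* T_m(G), with None for infinity. *)
Definition win_time_with (m : nat) : option nat :=
  if pselect (exists T, wins_in m T) is left h then Some (ex_minn h) else None.

Definition win_time : option nat := win_time_with ffn.

(* A graph is encoded by its adjacency matrix, row by row. *)
Definition encoding : seq bool :=
  [seq adj x y | x <- enum G, y <- enum G].

Definition gsize : nat := size encoding.

End Firefighting.

Section AuxiliaryGraph.
Variables alpha m : nat.

(* inl i is the clique node v_(i+1), inr j is the node w_(j+1). *)
Definition Hadj : rel ('I_m.-1 + 'I_alpha)%type := fun x y =>
  match x, y with
  | inl i, inl j => i != j
  | inl _, inr _ | inr _, inl _ => true
  | inr _, inr _ => false
  end.

Lemma Hadj_sym : symmetric Hadj.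
Proof. by move=> [i|i] [j|j] //=; rewrite eq_sym. Qed.

Lemma Hadj_irr : irreflexive Hadj.
Proof. by move=> [i|i] //=; rewrite eqxx. Qed.

Definition Hgraph : sgraph := SGraph Hadj_sym Hadj_irr.

End AuxiliaryGraph.

(* pathN i k is v^i_(k+1), and copyN i h is the node h of the copy H_m^i. *)
Inductive gnode (alpha beta m : nat) (X : sgraph) : Type :=
  | baseN of X
  | centerN
  | pathN of 'I_m & 'I_beta
  | copyN of 'I_m & Hgraph alpha m.

Arguments centerN {alpha beta m X}.

Section GNodeFinite.
Variables (alpha beta m : nat) (X : sgraph).
Local Notation node := (gnode alpha beta m X).
Local Notation code :=
  (X + (unit + (('I_m * 'I_beta) + ('I_m * Hgraph alpha m))))%type.

Definition gnode_code (x : node) : code :=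
  match x with
  | baseN y => inl y
  | centerN => inr (inl tt)
  | pathN i k => inr (inr (inl (i, k)))
  | copyN i h => inr (inr (inr (i, h)))
  end.

Definition gnode_decode (x : code) : node :=
  match x with
  | inl y => baseN _ _ _ y
  | inr (inl _) => centerN
  | inr (inr (inl (i, k))) => pathN _ _ i k
  | inr (inr (inr (i, h))) => copyN _ _ i h
  end.

Lemma gnode_codeK : cancel gnode_code gnode_decode.
Proof. by case. Qed.

HB.instance Definition _ := Finite.copy node (can_type gnode_codeK).

End GNodeFinite.

Section Construction.
Variables (alpha beta m : nat) (X : sgraph).
(* u i is the clique node of the i-th copy of H_m attached to the i-th path. *)
Variable u : 'I_m -> 'I_m.-1.

Definition Gadj : rel (gnode alpha beta m X) := fun x y =>
  match x, y with
  | baseN a, baseN b => adj a b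
  | baseN _, centerN | centerN, baseN _ => true
  | centerN, pathN _ k | pathN _ k, centerN => k == 0 :> nat
  | pathN i k, pathN j l =>
      (i == j) && ((k.+1 == l :> nat) || (l.+1 == k :> nat))
  | pathN i k, copyN j h | copyN j h, pathN i k =>
      [&& i == j, k.+1 == beta & h == inl (u i)]
  | copyN i h, copyN j g => (i == j) && adj h g
  | _, _ => false
  end.

Lemma Gadj_sym : symmetric Gadj.
Proof.
move=> [a||i k|i h] [b||j l|j g] //=; first exact: adj_sym.
- by rewrite eq_sym orbC.
- by rewrite eq_sym; congr (_ && _); apply: (@adj_sym (Hgraph alpha m)).
Qed.

Lemma Gadj_irr : irreflexive Gadj.
Proof.
move=> [a||i k|i h] //=; first exact: adj_irr.
- by rewrite eqxx orbb /= gtn_eqF.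
- by rewrite eqxx; apply: (@adj_irr (Hgraph alpha m)).
Qed.

Definition Gext : sgraph := SGraph Gadj_sym Gadj_irr.

End Construction.

Definition one_node : sgraph :=
  @SGraph unit (fun _ _ => false) (fun _ _ => erefl) (fun _ => erefl).

(* Ggraph alpha beta u m is G_m for m >= 2; u k holds the attachment choices
   made when building G_(k+2).  Starting the recursion from the one-node graph
   at m = 1 gives G_2 = G(2, one_node); the value at 0 is junk. *)
Fixpoint Ggraph (alpha beta : nat) (u : forall k, 'I_k.+2 -> 'I_k.+1)
    (m : nat) : sgraph :=
  match m with
  | 0 => one_node
  | m1.+1 =>
    match m1 with
    | 0 => one_node
    | k.+1 => @Gext alpha beta k.+2 (Ggraph alpha beta u m1) (u k)
    end
  end.

(* f grows faster than every polynomial in n, as m tends to infinity. *)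
Definition superpolynomial_in (f n : nat -> nat) : Prop :=
  forall C d : nat, exists M, forall m, M <= m -> C * n m ^ d < f m.

Definition bigO (f g : nat -> nat) : Prop :=
  exists C M, forall m, M <= m -> f m <= C * g m.

(* Main.v *)
Require Import Defs.
From mathcomp Require Import all_boot boolp zify.

(* A vertex burns at time t + 1 iff it or a neighbour burns unprotected at time
   t.  Clearing a copy of H_m takes alpha rounds with all m firefighters on it.

   With m firefighters: once k >= 1 copies are clear, push the fire back along
   their paths to c (k + 1 guards), guard c while the others clear X, push the
   fire along the remaining paths back into their copies, and clear one more
   copy.  As alpha <= 2 beta + 2, the fire of the other copies meanwhile reaches
   at most the attachment nodes of the clear ones.

   Lower bound: for m >= 3 the final clearings of the m copies occupy disjoint
   time intervals.  As alpha >= beta + 3, at the start of each but the first X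
   must be clear, since otherwise the fire would reach an already clear copy
   during it; and between the starts of two of them X burns completely at some
   time, since the fire of the copy cleared later passes through c.  So X is
   cleared from scratch, with one firefighter bound to c, between any two
   starts, whence T_m(G_m) >= (m - 1) T_(m-1)(G_(m-1)). *)

Set Implicit Arguments.
Unset Strict Implicit.
Unset Printing Implicit Defensive.

(** * Rounds of the fire and burning sets that can be extinguished *)

Definition step (G : sgraph) (B F : {set G}) : {set G} :=
  B :\: F :|: nbhd (B :\: F).

Lemma in_step (G : sgraph) (B F : {set G}) y :
  reflect (exists x, [/\ x \in B, x \notin F & (x == y) || adj x y])
          (y \in step B F).
Proof.
apply: (iffP idP) => [|[x [xB xF xy]]].
  rewrite !inE => /orP[/andP[yF yB]|/andP[_ /existsP[x]]].
    by exists y; rewrite eqxx.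
  by rewrite inE => /andP[/andP[xF xB] xy]; exists x; rewrite xy orbT.
rewrite !inE; case: (boolP ((y \notin F) && (y \in B))) => //= yA.
case/orP: xy => [/eqP xy|xy]; first by rewrite -xy xF xB in yA.
by apply/existsP; exists x; rewrite !inE xF xB.
Qed.

(** A fire burning on [B] can be put out with [m] firefighters per round. The inductive form lets
    strategies be composed backwards from the empty set, without sequences. *)
Inductive tame (G : sgraph) (m : nat) : {set G} -> Prop :=
  | tame0 : tame m set0
  | tameS (B F : {set G}) of #|F| <= m & tame m (step B F) : tame m B.

Lemma tame_sub (G : sgraph) m (A B : {set G}) :
  A \subset B -> tame m B -> tame m A.
Proof.
move=> AB tB; elim: tB A AB => {B} [|B F Fm _ IH] A AB.
  by move: AB; rewrite subset0 => /eqP->; exact: tame0.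
apply: (tameS Fm); apply: IH; apply/subsetP => y /in_step[x [xA xF xy]].
by apply/in_step; exists x; rewrite (subsetP AB).
Qed.

(** The strategies below track only upper estimates of the fire, so [B'] may exceed the true next
    burning set. *)
Lemma tame_step (G : sgraph) m (F B' B : {set G}) :
  #|F| <= m ->
  (forall x y, x \in B -> x \notin F -> (x == y) || adj x y -> y \in B') ->
  tame m B' -> tame m B.
Proof.
move=> Fm BB' tB'; apply: (tameS Fm); apply: tame_sub tB'.
by apply/subsetP => y /in_step[x [xB xF xy]]; exact: BB' xy.
Qed.

Lemma burning_foldl (G : sgraph) (s : seq {set G}) t : t <= size s ->
  burning s t = foldl (@step G) setT (take t s).
Proof.
elim: t => [|t IH] ts; first by rewrite take0.
by rewrite (take_nth set0) // -cats1 foldl_cat /= -IH // ltnW.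
Qed.

Lemma tame_wins (G : sgraph) m : tame m [set: G] -> exists T, wins_in G m T.
Proof.
suff win (B : {set G}) : tame m B ->
    exists2 s, strategy m s & foldl (@step G) B s = set0.
  move=> /win[s ms s0]; exists (size s); apply/existsP; exists (in_tuple s).
  by rewrite ms /winning /= burning_foldl // take_size s0 eqxx.
elim=> {B} [|B F Fm _ [s ms s0]]; first by exists [::].
by exists (F :: s) => //=; rewrite Fm.
Qed.

(** * The graph G(m, X) *)

Section Extension.
Variables (alpha beta m : nat) (X : sgraph) (u : 'I_m -> 'I_m.-1).
Local Notation G := (@Gext alpha beta m X u).
Local Notation base := (@baseN alpha beta m X).
Local Notation center := (@centerN alpha beta m X).
Local Notation pnode := (@pathN alpha beta m X).
Local Notation copy := (@copyN alpha beta m X).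

Definition in_copy (k : 'I_m) (y : G) : bool :=
  if y is copyN i _ then i == k else false.

Definition clique (k : 'I_m) : {set G} := [set copy k (inl a) | a : 'I_m.-1].

Lemma card_clique k : #|clique k| = m.-1.
Proof. by rewrite card_imset ?card_ord // => a b []. Qed.

Lemma mem_clique k i h :
  (copy i h \in clique k) = (i == k) && (if h is inl _ then true else false).
Proof.
apply/imsetP/andP => [[a _ [-> ->]]|[/eqP-> ]]; first by rewrite eqxx.
by case: h => // a _; exists a.
Qed.

Definition leaves (k : 'I_m) : {set G} := [set copy k (inr j) | j : 'I_alpha].

Lemma mem_leaves k i h :
  (copy i h \in leaves k) = (i == k) && (if h is inr _ then true else false).
Proof.
apply/imsetP/andP => [[a _ [-> ->]]|[/eqP-> ]]; first by rewrite eqxx.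
by case: h => // a _; exists a.
Qed.

(** * Upper bound: extinguishing G(m, X) with [m] firefighters *)

Section Upper.
Hypotheses (alpha_gt0 : 0 < alpha) (beta_gt0 : 0 < beta).
Hypotheses (alpha_le : alpha <= 2 * beta + 2).
Hypothesis m_gt1 : 1 < m.
Hypothesis tameX : tame m.-1 [set: X].

(** [m.-1] firefighters guard the clique in every round and the last one puts out the leaves one by
    one. [O t] bounds the fire coming from elsewhere, which may hit the guarded clique but never
    passes it. *)
Lemma clear_copy (k : 'I_m) (O : nat -> pred G) :
  (forall t x y, t < alpha -> ~~ in_copy k x -> O t x ->
     (x == y) || adj x y -> O t.+1 y) ->
  tame m [set y | O alpha y & y \notin leaves k] ->
  tame m [set y | O 0 y || in_copy k y].
Proof.
move=> Ostep tO.
(* After [t] rounds the first [t] leaves are out. The remaining leaves relight the guarded clique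
   until [t = alpha]; from then on only outside fire can be there. *)
pose S t : {set G} := [set y : G | match y with
  | copyN i (inl _) => ((i == k) && (t < alpha)) || O t y
  | copyN i (inr j) => if i == k then t <= j else O t y
  | _ => O t y end].
suff tS t : t <= alpha -> tame m (S (alpha - t)).
  apply: tame_sub (tS _ (leqnn _)); rewrite subnn; apply/subsetP => y.
  rewrite !inE; case: y => [x||i r|i [a|j]] /=;
    rewrite ?orbF ?alpha_gt0 ?andbT //.
    by rewrite orbC.
  by case: (i == k); rewrite ?orbF.
elim: t => [|t IH] ta.
  apply: tame_sub tO; apply/subsetP => y; rewrite subn0 !inE.
  case: y => [x||i r|i [a|j]] /=; rewrite ?mem_leaves ?ltnn ?andbT ?andbF //=.
  - by move=> ->; apply/imsetP => -[].
  - by move=> ->; apply/imsetP => -[].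
  - by move=> ->; apply/imsetP => -[].
  - by rewrite andbT.
  - by case: (i == k) => //=; have := ltn_ord j; lia.
have nlt : alpha - t.+1 < alpha by lia.
pose n := Ordinal nlt.
have nS : alpha - t = n.+1 by rewrite /= subnSK.
move: (IH (ltnW ta)); rewrite nS => {}IH.
apply: (@tame_step G m (copy k (inr n) |: clique k) _ _ _ _ IH) => [|x y].
  by rewrite (leq_trans (leq_card_setU _ _)) // cards1 card_clique; lia.
rewrite !inE negb_or => xS /andP[xn xc] xy.
have [xk|xk] := boolP (in_copy k x); last first.
  have On : O n x by move: xS xk; case: (x) => [z||i r|i [a|j]] //=;
    case: (i == k).
  have Oy := Ostep n x y (ltn_ord n) xk On xy.
  case: y Oy xy => [z||i r|i [a|j]] //= Oy xy; first by rewrite Oy orbT.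
  have [ik|//] := eqVneq i k; case/orP: xy xk => [/eqP->|];
    first by rewrite /= ik eqxx.
  case: x {xS xn xc On} => [z||i' r|i' h] //=; first by case/and3P.
  by case/andP => /eqP->; rewrite ik eqxx.
case: x xk xS xn xc xy => // i h /= /eqP->; rewrite mem_clique eqxx /=.
case: h => // j jn /eqP jn' _; have {}jn : n < j.
  rewrite ltn_neqAle jn andbT; apply/eqP => nj; case: jn';
    congr (copy _ (inr _)).
  exact/val_inj.
case/orP => [/eqP<-|]; first by rewrite eqxx.
case: y => [y||i' r|i' [a|j']] //=; [by case/and3P| |by rewrite andbF].
case/andP=> /eqP<- _; rewrite eqxx /=.
by have := ltn_ord j; move: jn => /=; lia.
Qed.

(** Upper estimate of the fire once [k] copies are clear: it may have returned to their attachment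
    nodes, but no farther. *)
Definition cleared (k : nat) (y : G) : bool :=
  if y is copyN i h then (k <= i) || (h == inl (u i)) else true.

(* A lower bound on the distance to the attachment nodes of the copies i > k. *)
Definition level (k : nat) (y : G) : nat :=
  match y with
  | baseN _ => beta + 2
  | centerN => beta + 1
  | pathN i r => if i <= k then beta + 2 + r else beta - r
  | copyN i h => if i <= k then 2 * beta + 2 + (h != inl (u i)) else 0
  end.

Lemma level_adj (k : 'I_m) (x y : G) :
  ~~ in_copy k x -> adj x y -> level k y <= (level k x).+1.
Proof.
case: x => [x||i r|i h]; case: y => [y||j l|j g] //= xk; try lia.
- by move=> /eqP->; case: ifP; lia.
- by move=> /eqP->; case: ifP; lia.
- by case/andP=> /eqP-> rl; have := ltn_ord r; have := ltn_ord l; case: ifP;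
    lia.
- by case/and3P=> /eqP-> rb /eqP->; rewrite eqxx; case: ifP; lia.
- by case/and3P=> /eqP-> rb /eqP->; rewrite eqxx; have := ltn_ord l;
    case: ifP; lia.
- by case/andP=> /eqP-> _; case: ifP => //; do 2!case: (_ != _); lia.
Qed.

Lemma clear_next (k : 'I_m) :
  (k.+1 < m -> tame m [set y : G | cleared k.+1 y]) ->
  tame m [set y : G | if y is copyN i _ then k <= i else false].
Proof.
(* Fire from the copies beyond [k] reaches only nodes of [level] at most [t] in [t] rounds. Nodes of
   clear copies other than attachment nodes have level [2 * beta + 3 > alpha]. For the last copy
   nothing else burns, so [O] is empty. *)
move=> tk; pose O t (y : G) := (k.+1 < m) && (level k y <= t).
apply: (@tame_sub _ _ _ [set y | O 0 y || in_copy k y]).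
  apply/subsetP => -[x||i r|i h]; rewrite !inE //= /O /= => ki.
  have [->|ik] := eqVneq i k; first by rewrite orbT.
  have {ki}ki : k < i by rewrite ltn_neqAle eq_sym ik.
  by rewrite (leqNgt i k) ki (leq_ltn_trans ki).
apply: clear_copy => [t x y ta xk /andP[km xt] xy|].
  rewrite /O km /=; case/orP: xy => [/eqP<-|xy]; first exact: leqW.
  exact: leq_trans (level_adj xk xy) _.
have [km|mk] := ltnP k.+1 m; last first.
  apply: (tame_sub _ (tame0 _ _)); apply/subsetP => y.
  by rewrite inE /O ltnNge mk.
apply: tame_sub (tk km); apply/subsetP => y; rewrite !inE /O km /=.
case: y => //= i h; case: (ltnP k i) => //= ik.
by case: (h == _) => //=; lia.
Qed.

(* The outermost burning node of branch i after p nodes have been put out,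
   starting with the attachment node. *)
Definition front_in (i : 'I_m) (p : nat) : G :=
  if p == 0 then copy i (inl (u i))
  else if p <= beta then
    (if insub (beta - p) is Some r then pnode i r else center)
  else center.

Lemma front_in_path i (r : 'I_beta) p : r + p = beta ->
  front_in i p = pnode i r.
Proof.
move=> rp; rewrite /front_in ifN; last by have := ltn_ord r; lia.
by rewrite ifT; [rewrite (_ : beta - p = r) ?valK //; lia|lia].
Qed.

Lemma front_in_center i p : beta < p -> front_in i p = center.
Proof. by move=> pb; rewrite /front_in ifN ?ifN //; lia. Qed.

Lemma card_ord_lt (k : nat) : k <= m -> #|[set i : 'I_m | i < k]| = k.
Proof.
move=> km; rewrite -[RHS](card_ord k).
have inj : injective (widen_ord km) by move=> i j [] /val_inj.
rewrite -(card_imset _ inj); apply: eq_card => i.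
rewrite !inE; apply/idP/imsetP => [ik|[j _ ->]]; last exact: (ltn_ord j).
by exists (Ordinal ik) => //; exact/val_inj.
Qed.

Lemma card_ord_ge (k : nat) : k <= m -> #|[set i : 'I_m | k <= i]| = m - k.
Proof.
move=> km; have := cardsC [set i : 'I_m | i < k];
  rewrite card_ord_lt // card_ord.
rewrite (_ : ~: _ = [set i : 'I_m | k <= i]); first by lia.
by apply/setP => i; rewrite !inE -leqNgt.
Qed.

Definition outer_part (k : nat) (D : {set X}) (y : G) : bool :=
  match y with
  | baseN x => x \in D
  | centerN => true
  | pathN i _ | copyN i _ => k <= i
  end.

(** Each of the [k] branches keeps a guard on its front. An extra firefighter on the next node of
    branch [i] makes that front recede by one, as both burning sources of the front node are then
    guarded. The sum counts the retreats still to be made. *)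
Lemma push_in (k : nat) : k < m ->
  tame m [set y : G | outer_part k setT y] -> tame m [set y : G | cleared k y].
Proof.
move=> km tk.
pose S (f : 'I_m -> nat) := [set y : G | match y with
  | pathN i r => (k <= i) || (r + f i <= beta)
  | copyN i h => (k <= i) || ((h == inl (u i)) && (f i == 0))
  | _ => true end].
suff tS n f : \sum_i (beta.+1 - f i) = n -> tame m (S f).
  apply: tame_sub (tS _ (fun=> 0) (erefl _)); apply/subsetP => y; rewrite !inE.
  case: y => [x||i r|i h] //=; last by rewrite andbT.
  by rewrite addn0 (ltnW (ltn_ord r)) orbT.
elim/ltn_ind: n f => n IH f fn.
have [/existsP[i /andP[ik fi]]|/existsPn none] :=
  boolP [exists i : 'I_m, (i < k) && (f i <= beta)]; last first.
  apply: tame_sub tk; apply/subsetP => y; rewrite !inE.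
  by case: y => [x||j r|j h] //=; have := none j; case: (leqP k j) => //= _;
    lia.
pose f' j := f j + (j == i).
pose F := front_in i (f i).+1 |: [set front_in j (f j) |
  j in [set j : 'I_m | j < k]].
have lt_sum : \sum_j (beta.+1 - f' j) < n.
  rewrite -fn (bigD1 i) // [ltnRHS](bigD1 i) //= /f' eqxx -addSn leq_add //;
    first lia.
  by apply: leq_sum => j; lia.
apply: (tame_step (F := F)) (IH _ lt_sum f' erefl) => [|x y].
  rewrite (leq_trans (leq_card_setU _ _)) // cards1.
  by rewrite (leq_trans _ km) //
    add1n ltnS (leq_trans (leq_imset_card _ _)) // card_ord_lt // ltnW.
have inF (j : 'I_m) : j < k -> front_in j (f j) \in F.
  by move=> jk; rewrite inE imset_f ?orbT // inE.
have inFi : front_in i (f i).+1 \in F by rewrite !inE eqxx.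
have pF (j : 'I_m) (r : 'I_beta) : j < k -> pnode j r \notin F ->
    (r + f j != beta) && ((j == i) ==> (r + (f j).+1 != beta)).
  move=> jk; apply: contraR; rewrite negb_and negb_imply !negbK.
  case/orP => [/eqP rf|/andP[/eqP-> /eqP rf]];
    last by rewrite -(front_in_path i rf).
  by rewrite -(front_in_path j rf) inF.
have cF (j : 'I_m) : j < k -> center \notin F ->
    (f j <= beta) && ((j == i) ==> ((f j).+1 <= beta)).
  move=> jk; apply: contraR; rewrite negb_and negb_imply -!ltnNge.
  case/orP => [fj|/andP[/eqP-> fj]]; last by rewrite -(front_in_center i fj).
  by rewrite -(front_in_center j fj) inF.
move=> + xF; rewrite !inE => xS.
case: x xS xF => [x||j r|j h] xS xF; case: y => [y||j' l|j' g] //=;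
  rewrite ?orbF.
- by move=> /eqP l0; have := cF j'; case: (leqP k j') => //= jk /(_ isT xF);
    rewrite /f'; case: (j' == i) => /=; lia.
- case: eqP => [[<- <-] _|_ /= /andP[/eqP <- rl]].
    by have := pF j r; case: (leqP k j) xS => //= jk xS /(_ isT xF);
      rewrite /f'; case: (j == i) => /=; lia.
  by have := pF j r; case: (leqP k j) xS => //= jk xS /(_ isT xF);
    rewrite /f'; case: (j == i) => /=; lia.
- case/and3P=> /eqP<- rb /eqP->; rewrite eqxx.
  by have := pF j r; case: (leqP k j) xS => //= jk xS /(_ isT xF);
    rewrite /f'; case: (j == i) => /=; lia.
- case/and3P=> /eqP-> rb /eqP hu;
    case: (leqP k j) xS xF => //= jk /andP[_ /eqP f0].
  by rewrite hu; have := inF j jk; rewrite f0 /front_in eqxx => ->.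
- case: (leqP k j) xS xF => //= jk; last first.
    by case/andP=> /eqP-> /eqP f0; have := inF j jk;
      rewrite f0 /front_in eqxx => ->.
  by case: eqP => [[<- _]|_ /= _ _ /andP[/eqP<- _]]; rewrite jk.
Qed.

(** A permanent guard on [center] separates [X] from the branches, while the other firefighters
    follow a strategy for [X]. *)
Lemma clear_base (k : nat) (D : {set X}) : tame m.-1 D ->
  tame m [set y : G | outer_part k set0 y] ->
    tame m [set y : G | outer_part k D y].
Proof.
move=> tD t0; elim: tD => // {}D F Fm _ IH.
apply: (@tame_step G m (center |: base @: F) _ _ _ _ IH) => [|x y].
  rewrite (leq_trans (leq_card_setU _ _)) // cards1.
  by rewrite add1n (leq_ltn_trans (leq_imset_card _ _)) ?(leq_ltn_trans Fm)
    ?ltn_predL ?(ltnW m_gt1).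
rewrite !inE negb_or => xS /andP[/eqP xc xF].
case: x xS xc xF => [x||j r|j h] xS xc xF; case: y => [y||j' l|j' g] //=;
  rewrite ?orbF.
- move=> xy; apply/in_step; exists x; split=> //.
  by apply: contra xF => xF; rewrite imset_f.
- by case/orP => [/eqP[<-]|/andP[/eqP<-]].
- by case/and3P => /eqP<-.
- by case/and3P => /eqP->.
- by case/orP => [/eqP[<-]|/andP[/eqP<-]].
Qed.

(* The burning node nearest to c on branch i after p path nodes have been put
   out. *)
Definition front_out (i : 'I_m) (p : nat) : G :=
  if insub p is Some r then pnode i r else copy i (inl (u i)).

(** The mirror image of [push_in]: the [m - k] burning branches each hold a guard, and [0 < k]
    leaves one firefighter to advance. *)
Lemma push_out (k : nat) : 0 < k <= m ->
  tame m [set y : G | if y is copyN i _ then k <= i else false] ->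
  tame m [set y : G |
    match y with pathN i _ | copyN i _ => k <= i | _ => false end].
Proof.
case/andP=> k0 km tk.
pose S (g : 'I_m -> nat) := [set y : G | match y with
  | pathN i r => (k <= i) && (g i <= r)
  | copyN i h => k <= i
  | _ => false end].
suff tS n g : \sum_i (beta - g i) = n -> tame m (S g).
  apply: tame_sub (tS _ (fun=> 0) (erefl _)); apply/subsetP => y; rewrite !inE.
  by case: y => [x||i r|i h] //=; rewrite andbT.
elim/ltn_ind: n g => n IH g gn.
have [/existsP[i /andP[ik gi]]|/existsPn none] :=
  boolP [exists i : 'I_m, (k <= i) && (g i < beta)]; last first.
  apply: tame_sub tk; apply/subsetP => y; rewrite !inE.
  by case: y => [x||j r|j h] //=; have := none j; case: (leqP k j) => //= _;
    have := ltn_ord r; lia.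
pose g' j := g j + (j == i).
pose F := front_out i (g i).+1 |: [set front_out j (g j) |
  j in [set j : 'I_m | k <= j]].
have lt_sum : \sum_j (beta - g' j) < n.
  rewrite -gn (bigD1 i) // [ltnRHS](bigD1 i) //= /g' eqxx -addSn leq_add //;
    first lia.
  by apply: leq_sum => j; lia.
apply: (tame_step (F := F)) (IH _ lt_sum g' erefl) => [|x y].
  rewrite (leq_trans (leq_card_setU _ _)) // cards1.
  apply: (@leq_trans (1 + (m - k))); last by lia.
  by rewrite leq_add2l (leq_trans (leq_imset_card _ _)) // card_ord_ge.
have inF (j : 'I_m) : k <= j -> front_out j (g j) \in F.
  by move=> jk; rewrite inE imset_f ?orbT // inE.
have inFi : front_out i (g i).+1 \in F by rewrite !inE eqxx.
have pF (j : 'I_m) (r : 'I_beta) : k <= j -> pnode j r \notin F ->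
    (g j != r) && ((j == i) ==> ((g j).+1 != r)).
  move=> jk; apply: contraR; rewrite negb_and negb_imply !negbK.
  case/orP => [/eqP rg|/andP[/eqP-> /eqP rg]]; last by move: inFi;
    rewrite /front_out rg valK.
  by have := inF j jk; rewrite /front_out rg valK.
have cF (j : 'I_m) : k <= j -> copy j (inl (u j)) \notin F ->
    (g j < beta) && ((j == i) ==> ((g j).+1 < beta)).
  move=> jk; apply: contraR; rewrite negb_and negb_imply.
  case/orP => [gj|/andP[/eqP-> gj]]; last by move: inFi;
    rewrite /front_out insubN.
  by have := inF j jk; rewrite /front_out insubN.
move=> + xF; rewrite !inE => xS.
case: x xS xF => [x||j r|j h] // xS xF; case: y => [y||j' l|j' h'] //=;
  rewrite ?orbF.
- by case/andP: xS => kj gr /eqP r0; have := pF j r kj xF; lia.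
- case/andP: xS => kj gr; have jr := pF j r kj xF.
  case/orP => [/eqP[<- <-]|/andP[/eqP<- rl]]; rewrite kj /= /g'; move: jr.
    by case: (j == i) => /=; lia.
  by case: (j == i) => /=; lia.
- by case/andP: xS => kj gr /and3P[/eqP<-].
- case/and3P=> /eqP jj lb /eqP hu; rewrite jj xS /=.
  by move: xF; rewrite hu jj => /(cF j xS); rewrite /g';
    case: (j == i) => /=; lia.
- by case: eqP => [[<- _]|_ /= /andP[/eqP<-]].
Qed.

Lemma tame_cleared (k : nat) : 0 < k < m -> tame m [set y : G | cleared k y].
Proof.
(* Downward induction on [k]: one cycle of the strategy leads from [cleared k] to [cleared k.+1]. *)
move: {2}(m - k) (erefl (m - k)) => n; elim: n k => [|n IH] k mk /andP[k0 km].
  by move: mk; lia.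
apply: push_in => //; apply: clear_base => //.
(* With [X] clear, this round puts out c and stops the burning branches at their first path
   nodes. *)
apply: (@tame_step G m (center |: [set pnode i (Ordinal beta_gt0) |
  i in [set i : 'I_m | k <= i]])
  [set y : G | match y with pathN i _ | copyN i _ => k <= i | _ => false end]).
- rewrite (leq_trans (leq_card_setU _ _)) // cards1.
  apply: (@leq_trans (1 + (m - k))); last by lia.
  by rewrite leq_add2l (leq_trans (leq_imset_card _ _)) // card_ord_ge // ltnW.
- move=> x y; rewrite !inE negb_or => xS /andP[/eqP xc xF].
  case: x xS xc xF => [x||j r|j h] //=; rewrite ?inE // => kj _ xF.
    case: y => [y||j' l|j' h'] //=; rewrite ?orbF.
    + move=> /eqP r0; case/negP: xF; apply/imsetP; exists j; rewrite ?inE //.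
      by congr (pnode _ _); exact/val_inj.
    + by case/orP => [/eqP[<-]|/andP[/eqP<-]].
    + by case/and3P => /eqP<-.
  case: y => [y||j' l|j' h'] //=; rewrite ?orbF.
  + by case/and3P => /eqP->.
  + by case/orP => [/eqP[<-]|/andP[/eqP<-]].
apply: push_out; first by rewrite k0 ltnW.
apply: (@clear_next (Ordinal km)) => /= km'; apply: IH; lia.
Qed.

Lemma tame_Gext : tame m [set: G].
Proof.
pose k0 : 'I_m := Ordinal (ltnW m_gt1).
(* During the first clearing everything else may burn, but copy [k0] is entered only at its
   attachment node. *)
pose O (t : nat) (y : G) :=
  if y is copyN i h then (i == k0) ==> (h == inl (u i)) else true.
apply: (@tame_sub _ _ _ [set y | O 0 y || in_copy k0 y]).
  by apply/subsetP => -[x||i r|i h] _; rewrite !inE //=;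
    case: (i == k0) => /=; rewrite ?orbT.
apply: clear_copy => [t x y _ xk _ xy|].
  case: y xy => [y||j l|j g] //= xy; apply/implyP => /eqP jk; move: xy.
  case: x xk => [x||i r|i h] //= ik; rewrite ?orbF;
    first by case/and3P => /eqP->.
  by case/orP => [/eqP[ij _]|/andP[/eqP ij _]]; move: ik; rewrite ij jk eqxx.
apply: tame_sub (tame_cleared (k := 1) m_gt1);
  apply/subsetP => -[x||i r|i h]; rewrite !inE //=.
case/andP => hu _; case: (posnP i) hu => // i0.
by rewrite (_ : i == k0) ?i0 //; apply/eqP/val_inj.
Qed.

End Upper.

(** * Lower bound: behaviour of the fire in G(m, X) under any strategy *)

Section Lower.
Variables B F : nat -> {set G}.
Hypothesis B0 : B 0 = setT.
Hypothesis BS : forall t, B t.+1 = step (B t) (F t).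
Hypothesis alpha_gt0 : 0 < alpha.

Lemma burn_next t (x y : G) :
  x \in B t -> x \notin F t -> (x == y) || adj x y -> y \in B t.+1.
Proof. by move=> xB xF xy; rewrite BS; apply/in_step; exists x. Qed.

Lemma burn_prev t (y : G) : y \in B t.+1 ->
  exists x, [/\ x \in B t, x \notin F t & (x == y) || adj x y].
Proof. by rewrite BS => /in_step. Qed.

Lemma clique_burns_copy t k a h :
  copy k (inl a) \in B t -> copy k (inl a) \notin F t -> copy k h \in B t.+1.
Proof.
move=> aB aF; apply: burn_next aB aF _; case: h => [b|j] /=;
  rewrite eqxx ?orbT //=.
by have [->|] := eqVneq a b; rewrite ?eqxx ?orbT.
Qed.

(** A leaf burns because it, or a clique node, burned unprotected one round before; either one is
    adjacent or equal to every clique node. *)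
Lemma leaf_burns_clique t k j a :
  copy k (inr j) \in B t -> copy k (inl a) \in B t.
Proof.
case: t => [|t]; first by rewrite B0 !inE.
move=> /burn_prev[x [xB xF]] /orP[/eqP xj|].
  by apply: burn_next xB xF _; rewrite xj /= eqxx orbT.
case: x xB xF => [x||i r|i [b|j']] xB xF //=; first by case/and3P.
  by case/andP=> /eqP ik _; move: xB xF; rewrite ik; exact: clique_burns_copy.
by rewrite andbF.
Qed.

(** An unguarded clique node relights the whole copy. Guarding the entire clique uses up all [m.-1]
    firefighters, and then the leaves stay alight and relight it. *)
Lemma copy_burns_forever k h t : 0 < m ->
  (forall t, #|F t| <= m.-1) -> copy k h \in B t.
Proof.
move=> m0 Fm; elim: t h => [|t IH] h; first by rewrite B0 inE.
have [/eqP cF|] := boolP (clique k == F t).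
  case: h => [a|j]; last first.
    by apply: burn_next (IH (inr j)) _ _; rewrite ?eqxx // -cF mem_clique andbF.
  pose j := Ordinal alpha_gt0.
  apply: burn_next (IH (inr j)) _ _; first by rewrite -cF mem_clique andbF.
  by rewrite /= eqxx orbT.
rewrite eqEcard card_clique Fm andbT => /subsetPn[_ /imsetP[a _ ->]].
exact: clique_burns_copy.
Qed.

Definition fire k t : {set 'I_alpha} := [set j | copy k (inr j) \in B t].

Lemma fireS k t : clique k \subset F t ->
  fire k t.+1 = fire k t :\: [set j | copy k (inr j) \in F t].
Proof.
move=> /subsetP kF; apply/setP => j; rewrite !inE; apply/idP/andP => [|[jF jB]].
  case/burn_prev=> x [xB xF] /orP[/eqP<- //|].
  case: x xB xF => [x||i r|i [b|j']] xB xF //=; first by case/and3P.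
    by case/andP=> /eqP ik _; case/negP: xF; apply: kF;
      rewrite mem_clique ik eqxx.
  by rewrite andbF.
by apply: burn_next jB jF _; rewrite eqxx.
Qed.

Lemma fire_full k t : ~~ (clique k \subset F t) -> fire k t != set0 ->
  fire k t.+1 = setT.
Proof.
move=> /subsetPn[_ /imsetP[a _ ->] aF] /set0Pn[j]; rewrite inE => jB.
apply/setP => j'; rewrite !inE; apply: clique_burns_copy aF.
exact: leaf_burns_clique jB.
Qed.

Lemma fire_relit k t : fire k t = set0 -> fire k t.+1 != set0 ->
  fire k t.+1 = setT.
Proof.
move=> k0 /set0Pn[j]; rewrite inE => /burn_prev[x [xB xF]] /orP[/eqP xj|].
  by have := in_set0 j; rewrite -k0 inE -xj xB.
case: x xB xF => [x||i r|i [b|j']] xB xF //=; first by case/and3P.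
  case/andP=> /eqP ik _; apply/setP => j'; rewrite !inE.
  by move: xB xF; rewrite ik; exact: clique_burns_copy.
by rewrite andbF.
Qed.

(** * The final clearing of a copy and the spread of fire meanwhile *)

Hypothesis Fm : forall t, #|F t| <= m.
Variable T : nat.
Hypothesis BT : B T = set0.

Lemma fireT k : fire k T = set0.
Proof. by apply/setP => j; rewrite !inE BT inE. Qed.

Lemma fullset_neq0 : [set: 'I_alpha] != set0.
Proof. by apply/set0Pn; exists (Ordinal alpha_gt0). Qed.

Record last_clearing (k : 'I_m) (s e : nat) : Prop := LastClearing {
  clearing_lt : s < e;
  clearing_le : e <= T;
  clearing_start : fire k s = setT;
  clearing_guard : forall t, s <= t < e -> clique k \subset F t;
  clearing_not_full : forall t, s < t <= e -> fire k t != setT;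
  clearing_end : forall t, e <= t <= T -> fire k t = set0
}.

(** [s] is the last time at which all leaves burn, [e] the first later time at which none does. A
    gap in the guard before [e], or a relit leaf after it, would make all leaves burn again. *)
Lemma last_clearing_exists k : exists s e, last_clearing k s e.
Proof.
pose P t := (t <= T) && (fire k t == setT).
have exP : exists t, P t.
  by exists 0; apply/eqP/setP => j; rewrite !inE B0 inE.
have Pb t : P t -> t <= T by case/andP.
case: (ex_maxnP exP Pb) => s /andP[sT /eqP sfull] smax.
pose Q t := (s <= t) && (fire k t == set0).
have exQ : exists t, Q t by exists T; rewrite /Q sT fireT eqxx.
case: (ex_minnP exQ) => e /andP[se /eqP e0] emin.
have {}se : s < e.
  rewrite ltn_neqAle se andbT; apply/eqP => ese.
  by have := fullset_neq0; rewrite -sfull ese e0 eqxx.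
have eT : e <= T by apply: emin; rewrite /Q sT fireT eqxx.
have nfull t : s < t <= T -> fire k t != setT.
  case/andP=> st tT; apply/negP => tfull; have := smax t.
  by rewrite /P tT tfull => /(_ isT); rewrite leqNgt st.
exists s, e; split=> // [t /andP[st te]|t /andP[st te]|t /andP[et tT]].
- apply/negPn/negP => kF; have : fire k t != set0.
    by apply/negP => t0; have := emin t; rewrite /Q st t0 => /(_ isT);
      rewrite leqNgt te.
  move=> /(fire_full kF)/eqP; apply/negP/nfull.
  by rewrite ltnS st (leq_trans te).
- by apply: nfull; rewrite st (leq_trans te).
- elim: t et tT => [|t IH]; first by rewrite leqn0 => /eqP<-.
  rewrite leq_eqVlt => /predU1P[<- //|et tT].
  apply/eqP/negPn/negP => /(fire_relit (IH et (ltnW tT)))/eqP.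
  by apply/negP/nfull; rewrite tT (leq_trans se) // ltnW.
Qed.

(* While copy k is cleared, at most one firefighter works outside of it, and
   none at all in the alpha rounds in which a leaf is put out.  A single
   firefighter never shortens a burning segment p_0, ..., p_l with l > 0, and
   the segment grows in each of these alpha rounds. *)
Lemma fire_spreads k s e (p : nat -> G) n : last_clearing k s e ->
  0 < n <= alpha -> (forall l, l < n -> adj (p l) (p l.+1)) ->
  (forall l, l <= n -> ~~ in_copy k (p l)) -> p 0 \in B s -> p n \in B e.
Proof.
move=> [se eT sfull guard nfull e0] /andP[n0 na] padj pk p0.
have fire_le t : #|fire k t| <= alpha by rewrite -[leqRHS]card_ord max_card.
(* Invariant: the segment burns at least up to the index [alpha - #|fire k (s + d)|], the number of
   leaves already out, capped at [n]. *)
suff spread d l : s + d <= e -> l <= n -> l + #|fire k (s + d)| <= alpha ->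
    p l \in B (s + d).
  have := spread (e - s) n; rewrite subnKC ?(ltnW se) // e0 ?leqnn ?eT //.
  by rewrite cards0 addn0; exact.
elim: d l => [|d IH] l; rewrite ?addn0 ?addnS => de ln.
  by rewrite sfull cardsT card_ord; case: l ln => // l _; lia.
set t := s + d in IH de *.
have kF : clique k \subset F t by apply: guard; rewrite leq_addr.
have FS := fireS kF.
have R1 : #|F t :\: clique k| <= 1.
  by rewrite cardsD (setIidPr kF) card_clique; have := Fm t; lia.
have pclique l' : l' <= n -> p l' \notin clique k.
  by move=> /pk; apply: contra => /imsetP[a _ ->] /=.
have Runiq x y : x \in F t -> y \in F t -> x \notin clique k ->
    y \notin clique k -> x = y.
  move=> xF yF xk yk; move/card_le1_eqP: R1; apply; rewrite inE ?xk ?yk //.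
(* If the one firefighter off the clique stands on a leaf, the segment is unprotected and grows by
   one node. *)
have [/existsP[j jF]|/existsPn noF] := boolP [exists j, copy k (inr j) \in F t].
  have jk : copy k (inr j) \notin clique k by rewrite mem_clique andbF.
  have pF l' : l' <= n -> p l' \notin F t.
    move=> l'n; apply/negP => lF; have := pk _ l'n.
    by rewrite (Runiq _ _ lF jF (pclique _ l'n) jk) /= eqxx.
  have W1 : #|fire k t| <= #|fire k t.+1|.+1.
    rewrite FS -(cardsID [set j0 | copy k (inr j0) \in F t] (fire k t)) -add1n.
    rewrite leq_add2r; apply/card_le1_eqP => a b; rewrite !inE.
    move=> /andP[_ aF] /andP[_ bF].
    have := Runiq _ _ aF bF; rewrite !mem_clique !andbF => /(_ isT isT).
    by case.
  case: l ln => [|l] ln lW.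
    by apply: burn_next (IH 0 _ _ _) (pF 0 _) _; rewrite ?eqxx ?add0n // ltnW.
  apply: burn_next (IH l _ _ _) (pF l _) _; rewrite ?(ltnW de) ?(ltnW ln) //.
    by move: lW; lia.
  by rewrite padj ?orbT.
have Wt : fire k t.+1 = fire k t.
  by rewrite FS; apply/setP => j; rewrite !inE noF.
(* The leaf fire is unchanged and not full at [t.+1], so a leaf is out already and [p 1] burns as
   well. A protected [p l] therefore has a burning unprotected neighbour. *)
have Wlt : #|fire k t| < alpha.
  rewrite ltn_neqAle fire_le andbT -Wt; apply/eqP => Wa.
  have /negP[] := nfull t.+1 (ltac:(by rewrite de ltnS leq_addr)).
  by rewrite eqEcard subsetT cardsT card_ord Wa /=.
rewrite Wt => lW; have lB := IH l (ltnW de) ln lW.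
have [lF|lF] := boolP (p l \in F t); last by apply: burn_next lB lF _;
  rewrite eqxx.
have nbF l' : l' <= n -> adj (p l') (p l) -> p l' \notin F t.
  move=> l'n ll; apply/negP => lF'.
  move: ll; rewrite (Runiq _ _ lF' lF (pclique _ l'n) (pclique _ ln)).
  by rewrite adj_irr.
case: l ln lW lB lF nbF => [|l] ln lW lB lF nbF.
  have p10 : adj (p 1) (p 0) by rewrite adj_sym padj.
  apply: burn_next (IH 1 (ltnW de) n0 _) (nbF 1 n0 p10) _; first by [].
  by rewrite p10 orbT.
apply: burn_next (IH l (ltnW de) (ltnW ln) _) (nbF l (ltnW ln) _) _.
- by move: lW; lia.
- exact: padj.
- by rewrite padj ?orbT.
Qed.

(** The route from [x] through c and along branch [i] to its attachment node and on to [h]. Its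
    [beta + 3] edges explain the condition [beta + 3 <= alpha]. *)
Definition track (x : X) (i : 'I_m) (h : Hgraph alpha m) (l : nat) : G :=
  match l with
  | 0 => base x
  | 1 => center
  | r.+2 => if insub r is Some r' then pnode i r'
            else if r == beta then copy i (inl (u i)) else copy i h
  end.

Lemma track_path x i h (r : 'I_beta) : track x i h r.+2 = pnode i r.
Proof. by rewrite /track valK. Qed.

Lemma track_attach x i h : track x i h beta.+2 = copy i (inl (u i)).
Proof. by rewrite /track insubN ?ltnn // eqxx. Qed.

Lemma track_end x i h : track x i h beta.+3 = copy i h.
Proof. by rewrite /track insubN ?ltnNge ?leqnSn // gtn_eqF. Qed.

Lemma track_adj x i (h : Hgraph alpha m) l : 0 < beta ->
  adj (inl (u i) : Hgraph alpha m) h ->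
  l < beta.+3 -> adj (track x i h l) (track x i h l.+1).
Proof.
move=> b0 uh; case: l => [|[|r]] //.
  by move=> _; rewrite (track_path x i h (Ordinal b0)).
rewrite !ltnS leq_eqVlt => /predU1P[->|rb].
  by rewrite track_attach track_end /= eqxx.
rewrite (track_path x i h (Ordinal rb)).
have [rb'|rb'] := ltnP r.+1 beta.
  by rewrite (track_path x i h (Ordinal rb')) /= !eqxx.
have -> : r.+1 = beta by lia.
by rewrite track_attach /= !eqxx andbT; apply/eqP; lia.
Qed.

Lemma track_not_in_copy x i h k l : i != k -> ~~ in_copy k (track x i h l).
Proof.
by move=> ik; case: l => [|[|r]] //=; case: insubP => //= _; case: ifP.
Qed.

Lemma center_burns_base t x :
  center \in B t -> center \notin F t -> base x \in B t.+1.
Proof. by move=> cB cF; exact: burn_next cB cF _. Qed.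

Lemma base_burns_center t x : base x \in B t -> center \in B t.
Proof.
case: t => [|t]; first by rewrite B0 !inE.
case/burn_prev => -[y||i r|i h] [yB yF] // _; apply: burn_next yB yF _ => //.
Qed.

Definition base_fire t : {set X} := [set x | base x \in B t].

Lemma base_fireS t : center \notin B t :\: F t ->
  base_fire t.+1 = step (base_fire t) [set x | base x \in F t].
Proof.
move=> cBF; apply/setP => x; rewrite inE;
  apply/idP/in_step => [|[y [yB yF xy]]].
  case/burn_prev => -[y||i r|i h] [yB yF] //= xy;
    last by rewrite inE yB yF in cBF.
  by exists y; rewrite !inE.
by rewrite !inE in yB yF; apply: burn_next yB yF _.
Qed.

(* From the last time at which X burns completely, c is not allowed to pass on
   fire; as c keeps burning as long as X does, it needs its own firefighter. *)
Lemma clear_base_time L a b :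
  (forall s : seq {set X}, strategy m.-1 s -> winning s -> L <= size s) ->
  a <= b -> base_fire a = setT -> base_fire b = set0 -> a + L <= b.
Proof.
move=> minL ab a1 b0.
pose P t := (t <= b) && (base_fire t == setT).
have exP : exists t, P t by exists a; rewrite /P ab a1 eqxx.
have Pb t : P t -> t <= b by case/andP.
case: (ex_maxnP exP Pb) => t0 /andP[t0b /eqP t01] t0max.
have at0 : a <= t0 by apply: t0max; rewrite /P ab a1 eqxx.
pose Q n := base_fire (t0 + n) == set0.
have exQ : exists n, Q n by exists (b - t0); rewrite /Q subnKC ?b0.
case: (ex_minnP exQ) => n /eqP n0 nmin.
have nb : n <= b - t0 by apply: nmin; rewrite /Q subnKC ?b0.
have cBF k : k < n -> center \notin B (t0 + k) :\: F (t0 + k).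
  move=> kn; apply/negP; rewrite inE => /andP[cF cB].
  have /negP[] : ~~ P (t0 + k).+1 by apply/negP => /t0max;
    rewrite ltnNge leq_addr.
  apply/andP; split; first lia.
  by apply/eqP/setP => x; rewrite !inE (center_burns_base _ cB cF).
pose E k : {set X} := [set x | base x \in F (t0 + k)].
have nthE i : i < n -> nth set0 (mkseq E n) i = E i by move=> ?;
  rewrite nth_mkseq.
have burnE k : k <= n -> burning (mkseq E n) k = base_fire (t0 + k).
  elim: k => [|k IH] kn; first by rewrite addn0 t01.
  rewrite addnS base_fireS ?cBF // -/(step _ _).
  by rewrite -(IH (ltnW kn)) -/(E k) -nthE.
suff : L <= n by lia.
rewrite -[n](size_mkseq E); apply: minL; last first.
  by rewrite /winning size_mkseq burnE // n0.
apply/(all_nthP set0) => k; rewrite size_mkseq => kn; rewrite nthE //.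
have cF : center \in F (t0 + k).
  apply/negPn/negP => cF; have /negP[] := cBF _ kn; rewrite inE cF /=.
  have : base_fire (t0 + k) != set0.
    by apply/negP => /nmin; rewrite leqNgt kn.
  by case/set0Pn => x; rewrite inE; exact: base_burns_center.
rewrite -ltnS prednK; last by apply: leq_trans (Fm (t0 + k));
  apply/card_gt0P; exists center.
apply: leq_trans (Fm (t0 + k)); rewrite [ltnRHS](cardsD1 center) cF ltnS.
rewrite -(card_imset (f := base)); last by move=> x y [].
by apply/subset_leq_card/subsetP => _ /imsetP[x xE ->]; rewrite !inE in xE *.
Qed.

(** Guarding two cliques at once takes [2 * (m - 1)] firefighters, more than [m] when [m > 2]. *)
Lemma clearing_disjoint i j s e s' e' t : 2 < m -> i != j ->
  last_clearing i s e -> last_clearing j s' e' ->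
  s <= t < e -> s' <= t < e' -> False.
Proof.
move=> m2 ij ci cj ti tj.
have iF := clearing_guard ci ti; have jF := clearing_guard cj tj.
have : clique i :|: clique j \subset F t by rewrite subUset iF jF.
move=> /subset_leq_card; rewrite cardsU !card_clique.
rewrite (_ : clique i :&: clique j = set0) ?cards0; first by have := Fm t; lia.
apply/setP => y; rewrite !inE; apply/andP => -[/imsetP[a _ ->]].
by rewrite mem_clique (negPf ij).
Qed.

Lemma clearing_gap L i j s e s' e' : 2 < m -> 0 < beta -> beta + 3 <= alpha ->
  (forall s : seq {set X}, strategy m.-1 s -> winning s -> L <= size s) ->
  i != j -> last_clearing i s e -> last_clearing j s' e' -> s <= s' ->
  s + L <= s'.
Proof.
move=> m2 b0 ba minL ij ci cj ss'.
have se := clearing_lt ci; have se' := clearing_lt cj.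
have es' : e <= s'.
  rewrite leqNgt; apply/negP => s'e.
  by apply: (clearing_disjoint (t := s') m2 ij ci cj); rewrite ?ss' ?leqnn.
pose w : 'I_alpha := Ordinal alpha_gt0.
have b30 : 0 < beta.+3 <= alpha by rewrite addn3 in ba; rewrite ba.
(* Fire in [X] at time [s'] would reach a leaf of copy [i] by [e'], although that copy is clear from
   [e] on. *)
have clean : base_fire s' = set0.
  apply/setP => x; rewrite !inE; apply/negP => xB.
  have := fire_spreads (p := track x i (inr w)) cj b30.
  rewrite track_end => /(_ _ _ xB) wB.
  have := clearing_end ci (t := e'); rewrite (clearing_le cj) andbT.
  move=> /(_ (ltnW (leq_ltn_trans es' se')))/setP/(_ w); rewrite !inE wB //.
  - by move=> l lb; apply: track_adj.
  - by move=> l lb; apply: track_not_in_copy.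
suff [t /andP[st ts'] t1] : exists2 t, s <= t <= s' & base_fire t = setT.
  by have := clear_base_time minL ts' t1 clean; lia.
pose R (y : G) := match y with pathN k _ | copyN k _ => k == j | _ => false end.
(* If branch or copy [j] burns anywhere at time [s], the reversed track carries this fire to every
   node of [X] during the clearing of copy [i]. *)
have [/existsP[y /andP[yR yB]]|/existsPn noR] :=
  boolP [exists y, R y && (y \in B s)].
  exists e; first by rewrite es' ltnW.
  apply/setP => x; rewrite !inE.
  (* A node [y] beyond the attachment node is its own endpoint [h]; otherwise an arbitrary leaf
     completes the track. *)
  have [h [n [uh n0 nb hn]]] : exists h n,
      [/\ adj (inl (u j) : Hgraph alpha m) h, 0 < n, n <= beta.+3 & track x j h n = y].
    case: y yR yB => [y||k r|k h] //= /eqP-> _.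
      by exists (inr w), r.+2; rewrite track_path; split=> //;
        have := ltn_ord r; lia.
    have [->|hu] := eqVneq h (inl (u j)).
      by exists (inr w), beta.+2; rewrite track_attach.
    exists h, beta.+3; rewrite track_end; split=> //.
    by case: h hu => [a|//] /=; apply: contraNneq => ->.
  have := fire_spreads (p := fun l => track x j h (n - l)) (n := n) ci.
  rewrite subnn; apply=> //.
  - by rewrite n0; lia.
  - move=> l ln; rewrite adj_sym -(subnSK ln); apply: track_adj => //.
    by lia.
  - by move=> l _; apply: track_not_in_copy; rewrite eq_sym.
  - by rewrite subn0 hn.
(* Otherwise the fire of copy [j] at [s'] has entered through c, which burned unguarded and so set
   all of [X] alight one round later. *)
have [/existsP[t /and3P[st cB cF]]|/existsPn noC] := boolP [exists t : 'I_s',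
    [&& s <= t, center \in B t & center \notin F t]].
  exists t.+1; first by rewrite (leqW st) ltn_ord.
  by apply/setP => x; rewrite !inE (center_burns_base _ cB cF).
suff noB d : s + d <= s' -> forall y, R y -> y \notin B (s + d).
  have := noB (s' - s); rewrite subnKC // => /(_ (leqnn _) (copy j (inr w))).
  rewrite /= eqxx => /(_ isT); have := clearing_start cj => /setP/(_ w).
  by rewrite !inE => ->.
elim: d => [|d IH] ds y yR; first by rewrite addn0; have := noR y; rewrite yR.
rewrite addnS in ds *; apply/negP => /burn_prev[x [xB xF xy]].
have [xR|xR] := boolP (R x); first by have := IH (ltnW ds) x xR; rewrite xB.
have xc : x = center.
  case: x y yR xR xy {xB xF} => [x||k r|k h] [y||k' r'|k' h'] //= /eqP-> kj.
  - by case/orP=> [/eqP[kk _]|/andP[/eqP kk _]]; rewrite kk eqxx in kj.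
  - by case/and3P=> /eqP kk; rewrite kk eqxx in kj.
  - by case/and3P=> /eqP kk; rewrite kk eqxx in kj.
  - by case/orP=> [/eqP[kk _]|/andP[/eqP kk _]]; rewrite kk eqxx in kj.
by have := noC (Ordinal ds); rewrite /= leq_addr -xc xB xF.
Qed.

Lemma burn_time_lower L : 2 < m -> 0 < beta -> beta + 3 <= alpha ->
  (forall s : seq {set X}, strategy m.-1 s -> winning s -> L <= size s) ->
  m.-1 * L <= T.
Proof.
move=> m2 b0 ba minL; case: (posnP L) => [->|L0]; first by rewrite muln0.
have [s /fin_all_exists[e cl]] := fin_all_exists last_clearing_exists.
(* Starts at least [L] apart have distinct quotients by [L]; [T < m.-1 * L] would squeeze [m] of
   them into [m.-1] values. *)
have gap i j : i != j -> s i <= s j -> s i %/ L < s j %/ L.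
  move=> ij sij; have := clearing_gap m2 b0 ba minL ij (cl i) (cl j) sij.
  by rewrite leq_divRL //; apply: leq_trans;
    rewrite mulSn addnC leq_add2r leq_trunc_div.
rewrite leqNgt; apply/negP => TL.
have sL i : s i %/ L < m.-1.
  rewrite ltn_divLR // (leq_trans _ (ltnW TL)) //.
  exact: leq_trans (clearing_lt (cl i)) (clearing_le (cl i)).
pose f i := Ordinal (sL i).
have inj : injective f.
  move=> i j /(congr1 val) /= sij; apply/eqP/negPn/negP => ij.
  case/orP: (leq_total (s i) (s j)) => [/(gap _ _ ij)|];
    first by rewrite sij ltnn.
  by rewrite eq_sym in ij; move/(gap _ _ ij); rewrite sij ltnn.
by have := leq_card f inj; rewrite !card_ord; lia.
Qed.

End Lower.
End Extension.

(** * The graphs G_m: firefighter number, time and size *)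

Lemma strategy_nth (G : sgraph) m (s : seq {set G}) t :
  strategy m s -> #|nth set0 s t| <= m.
Proof.
move=> /all_nthP ms; have [ts|st] := ltnP t (size s); first exact: ms.
by rewrite nth_default // cards0.
Qed.

Section Graphs.
Variables (alpha beta : nat) (u : forall k, 'I_k.+2 -> 'I_k.+1).
Hypotheses (alpha_gt0 : 0 < alpha) (beta_gt0 : 0 < beta).
Hypotheses (alpha_le : alpha <= 2 * beta + 2) (alpha_ge : beta + 3 <= alpha).

Local Notation G := (Ggraph alpha beta u).

Lemma Ggraph_tame m : tame m.+1 [set: G m.+1].
Proof.
elim: m => [|m IH]; last exact: tame_Gext.
apply: (@tame_step one_node 1 setT set0); last exact: tame0.
  by rewrite cardsT card_unit.
by move=> x y _; rewrite inE.
Qed.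

Lemma Ggraph_no_win m m' (s : seq {set G m}) :
  1 < m -> m' < m -> strategy m' s -> ~~ winning s.
Proof.
case: m s => [|[|k]] // s _ mk ms; apply/negP => /eqP sT.
have := @copy_burns_forever alpha beta k.+2 (G k.+1) (@u k) (burning s)
  (nth set0 s)
  erefl (fun=> erefl) alpha_gt0 ord0 (inr (Ordinal alpha_gt0)) (size s) isT.
by rewrite sT inE => /(_ (fun t => leq_trans (strategy_nth t ms) mk)).
Qed.

Lemma winning_size_gt0 (H : sgraph) (x : H) (s : seq {set H}) :
  winning s -> 0 < size s.
Proof. by case: s => //= /eqP/setP/(_ x); rewrite !inE. Qed.

Lemma Ggraph_time m (s : seq {set G m.+1}) :
  strategy m.+1 s -> winning s -> m`! <= size s.
Proof.
elim: m s => [|m IH] s ms ws; first exact: (winning_size_gt0 (tt : one_node)).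
(* For G_2 the bound is [1], so a nonempty graph suffices; the clearing argument starts at G_3. *)
case: m IH s ms ws => [|m] IH s ms ws.
  exact: (winning_size_gt0 (centerN : @Gext alpha beta 2 (G 1) (@u 0))).
rewrite factS.
apply: (@burn_time_lower alpha beta m.+3 (G m.+2) (@u m.+1) (burning s)
  (nth set0 s)) => //.
- by move=> t; exact: strategy_nth.
- exact/eqP.
Qed.

Lemma Ggraph_ffn m : 1 < m -> ffn (G m) = m.
Proof.
move=> m1; rewrite /ffn; case: ex_minnP => n /andP[n0 /asboolP[T]].
move=> /existsP[s /andP[ms ws]] nmin; apply/eqP; rewrite eqn_leq; apply/andP;
  split.
  apply: nmin; rewrite (ltnW m1); apply/asboolP/tame_wins.
  by case: m m1 {s ms ws} => // m _; exact: Ggraph_tame.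
by rewrite leqNgt; apply/negP => nm; have := Ggraph_no_win m1 nm ms; rewrite ws.
Qed.

Lemma card_Gext_le m X (v : 'I_m -> 'I_m.-1) :
  #|@Gext alpha beta m X v| <= #|X| + (1 + (m * beta + m * (m.-1 + alpha))).
Proof.
have := leq_card _ (can_inj (@gnode_codeK alpha beta m X)).
by rewrite !card_sum !card_prod !card_sum !card_ord card_unit.
Qed.

(** Building G_m adds O(m^2) nodes, so their total is cubic; squaring it for the adjacency matrix
    gives the sixth power. *)
Lemma card_Ggraph_le m : #|G m.+1| <= (alpha + beta + 2) * m.+1 ^ 3.
Proof.
elim: m => [|m IH]; first by rewrite card_unit; lia.
apply: leq_trans (@card_Gext_le m.+2 (G m.+1) (@u m)) _;
  apply: leq_trans (leq_add IH (leqnn _)) _.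
rewrite /= !expnS expn0 !muln1; nia.
Qed.

Lemma gsizeE (H : sgraph) : gsize H = #|H| ^ 2.
Proof. by rewrite /gsize /encoding size_allpairs -cardE. Qed.

Lemma gsize_Ggraph_le m : 0 < m ->
  gsize (G m) <= (alpha + beta + 2) ^ 2 * m ^ 6.
Proof.
case: m => // m _; rewrite gsizeE (expnM _ 3 2) -expnMn leq_exp2r //.
exact: card_Ggraph_le.
Qed.

End Graphs.

(** * Superpolynomial growth of the factorial *)

Lemma ffact_ge n k : (n - k) ^ k.+1 <= n ^_ k.+1.
Proof.
elim: k n => [|k IH] [|n]; rewrite ?ffactn1 ?expn1 ?subn0 //.
by rewrite subSS ffactSS expnS leq_mul ?IH // (leq_trans (leq_subr _ _)).
Qed.

Lemma fact_superpolynomial K d :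
  exists M, forall m, M <= m -> K * m ^ d < (m - 1)`!.
Proof.
(* The linear terms in [d] give [m <= 2 * (m - 1 - d)], hence [(m - 1)! >= (m / 2) ^ (d + 1)]; the
   first term lets the extra factor [m] beat [K * 2 ^ d.+1]. *)
exists (K * 2 ^ d.+1 + 2 * d + 3) => m mM.
have m0 : 0 < m by lia.
rewrite -(ltn_pmul2l (expn_gt0 2 d.+1 : 0 < 2 ^ d.+1)).
apply: (@leq_trans (m ^ d.+1)).
  by rewrite mulnA (mulnC _ K) [m ^ d.+1]expnS ltn_pmul2r ?expn_gt0 ?m0 //; lia.
apply: (@leq_trans (2 ^ d.+1 * (m - 1 - d) ^ d.+1)).
  by rewrite -expnMn leq_exp2r //; lia.
rewrite leq_pmul2l ?expn_gt0 // (leq_trans (ffact_ge _ _)) //.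
by rewrite -(@ffact_fact (m - 1) d.+1) ?leq_pmulr ?fact_gt0 //; lia.
Qed.

Theorem theorem4 (alpha beta : nat) (u : forall k : nat, 'I_k.+2 -> 'I_k.+1)
  (halpha : 0 < alpha) (hbeta : 0 < beta)
  (hle : alpha <= 2 * beta + 2) (hge : beta + 3 <= alpha) :
  [/\ forall m : nat, 2 <= m ->
        [/\ ffn (Ggraph alpha beta u m) = m,
            win_time (Ggraph alpha beta u m)
              = win_time_with (Ggraph alpha beta u m) m
          & exists2 t : nat,
              win_time (Ggraph alpha beta u m) = Some t & (m - 1)`! <= t],
      superpolynomial_in (fun m => (m - 1)`!)
                         (fun m => gsize (Ggraph alpha beta u m))
    & bigO (fun m => gsize (Ggraph alpha beta u m)) (fun m => m ^ 6)].
Proof.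
split=> [m m2|C d|].
- have ffnE := Ggraph_ffn u halpha hbeta hle m2; split=> //.
    by rewrite /win_time ffnE.
  rewrite /win_time ffnE /win_time_with; case: pselect => [wins|[]]; last first.
    by apply: tame_wins; case: m m2 ffnE => // m _ _; exact: Ggraph_tame.
  exists (ex_minn wins) => //; case: ex_minnP => T /existsP[s /andP[ms ws]] _.
  rewrite -[T](size_tuple s).
  by case: m m2 s ms ws {ffnE wins} => // m _ s ms ws; rewrite subn1;
    exact: (Ggraph_time (alpha := alpha) (beta := beta) (u := u)).
- have [M MP] := fact_superpolynomial
    (C * ((alpha + beta + 2) ^ 2) ^ d) (6 * d).
  (* The successor makes [m] positive, as the size bound requires. *)
  exists M.+1 => m Mm; apply: leq_ltn_trans (MP m (ltnW Mm)).
  rewrite -mulnA leq_mul2l expnM -expnMn; case: (posnP d) => [->|d0];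
    first by rewrite orbT.
  by rewrite leq_exp2r // gsize_Ggraph_le ?orbT // (leq_trans _ Mm).
- by exists ((alpha + beta + 2) ^ 2), 1 => m m1; exact: gsize_Ggraph_le.
Qed.
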